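(* Let $\eta(u,v)\in\mathbb{R}[u,v]^d$ be an algebraic estimator of the form $$X=\eta(u,v)=\eta(u,0)+\sum_{i=p+1}^{d} v_{i-p}\, e_i(u)+ c\sum_{j=1}^p f_j(u,v)\, e_j(u),$$ where $c\in\mathbb{R}$ is a constant; for each $u$ the vectors $e_1(u),\dots,e_d(u)$ form a basis of $\mathbb{R}^d$ such that $e_i(u)^\top \bar G(\eta(u,0))\,\partial_{u^a}\eta(u,0)=0$ for all $i=p+1,\dots,d$ and $a=1,\dots,p$; and $f_1,\dots,f_p$ are polynomials in $v$, with coefficients in $\mathbb{R}[u]$, all of whose terms have degree at least $3$ in $v$. Then this estimator satisfies the second-order efficiency condition $$\left.\sum_{i=1}^d\frac{\partial^2 \eta_i(u,v)}{\partial v^\kappa\,\partial v^\lambda}\,\frac{\partial \theta^i(u,v)}{\partial u^a}\right|_{v=0}=0\qquad\text{for all } \kappa,\lambda\in\{1,\dots,d-p\},\ a\in\{1,\dots,p\}.$$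
   Context: Full exponential family: $dP(x|\theta)=\exp(\sum_i x_i\theta^i-\psi(\theta))\,d\nu$, $x\in\mathbb{R}^d$, $\theta\in\Theta\subset\mathbb{R}^d$, with carrier measure $\nu$ and smooth potential $\psi$. The expectation parameter is $\eta(\theta)=\nabla_\theta\psi(\theta)$, and $\theta\mapsto\eta(\theta)$ is locally invertible with inverse $\theta(\eta)$. The Fisher metric with respect to $\theta$ is $g_{ij}(\theta)=\partial^2\psi/\partial\theta^i\partial\theta^j$ (positive definite), and $\bar G(\eta)=(g^{ij})$ is its inverse matrix, the Fisher metric with respect to $\eta$. The model is a curved exponential family of dimension $p<d$, with expectation parameter space $\mathcal{V}_E\subset\mathbb{R}^d$. It is algebraic: $\mathcal{V}_\Theta$ (its natural parameter space) or $\mathcal{V}_E$ is a real algebraic variety, and the relation between $\theta$ and $\eta$ is locally given by polynomial equations. $\mathcal{V}_E$ is nonsingular of dimension $p$ around the true parameter. An estimator is given by a local coordinate system $w=(u,v)\in\mathbb{R}^p\times\mathbb{R}^{d-p}$, $w\mapsto\eta(w)$, around the true parameter, such that $u\mapsto\eta(u,0)$ is a regular parametrization of $\mathcal{V}_E$; the sample mean $X\in\mathbb{R}^d$ is written $X=\eta(u,v)$ and the estimate is the component $u$. We write $\theta(u,v)=\theta(\eta(u,v))$. The estimator is algebraic if $w\mapsto\eta(w)$ or $w\mapsto\theta(w)$ is given algebraically. *)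

(* Defs.v *)
From HB Require Import structures.
From mathcomp Require Import all_boot all_order all_algebra.
From mathcomp Require Import all_classical all_reals all_analysis.
From mathcomp Require Import -(notations) mpoly.

Set Implicit Arguments.
Unset Strict Implicit.
Unset Printing Implicit Defensive.

Import Order.TTheory GRing.Theory Num.Theory.
Import numFieldNormedType.Exports.

Local Open Scope classical_set_scope.
Local Open Scope ring_scope.

(* Points of R^n are row vectors.  [mpoly n R] is the ring of polynomials in n
   variables over R; its bracket notation is not imported because the notations
   of multinomials clash with those of MathComp-Analysis. *)

Definition poly_eval (R : realType) (n : nat) (P : mpoly n R)
    (x : 'rV[R]_n) : R :=
  meval (fun i => x ord0 i) P.

(* Evaluation of a polynomial in v whose coefficients are polynomials in u. *)
Definition poly_eval2 (R : realType) (p q : nat)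
    (P : mpoly q (mpoly p R)) (u : 'rV[R]_p) (v : 'rV[R]_q) : R :=
  poly_eval (map_mpoly (meval (fun i => u ord0 i)) P) v.

Definition min_degree_ge (A : nzRingType) (q k : nat) (P : mpoly q A) :=
  forall m, m \in msupp P -> (k <= mdeg m)%N.

Definition zero_locus (R : realType) (n k : nat) (P : 'I_k -> mpoly n R) :
    set 'rV[R]_n :=
  [set x | forall l, poly_eval (P l) x = 0].

Section Calculus.
Variables (R : realType) (n : nat).
Implicit Types (U : set 'rV[R]_n) (f : 'rV[R]_n -> R) (x : 'rV[R]_n).

Definition partial (i : 'I_n) f x : R := 'D_(delta_mx ord0 i) f x.

(* C^infinity on U: all iterated partial derivatives exist and are continuous
   at every point of U.  Existence is required separately since ['D_v] is
   total. *)
Definition smooth_on U f : Prop :=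
  forall (s : seq 'I_n) x, U x ->
    {for x, continuous (foldr partial f s)} /\
    forall i : 'I_n, derivable (foldr partial f s) x (delta_mx ord0 i).

Definition smooth_map_on (m : nat) U (g : 'rV[R]_n -> 'rV[R]_m) : Prop :=
  forall j : 'I_m, smooth_on U (fun x => g x ord0 j).

End Calculus.

Section Geometry.
Variable R : realType.

Record local_coordinate_system (n : nat) (W : set 'rV[R]_n)
    (phi : 'rV[R]_n -> 'rV[R]_n) (x0 : 'rV[R]_n) : Prop := {
  lcs_open : open W;
  lcs_point : (phi @` W) x0;
  lcs_smooth : smooth_map_on W phi;
  lcs_inj : forall w w', W w -> W w' -> phi w = phi w' -> w = w';
  lcs_regular : forall w, W w -> 'J phi w \in unitmx
}.

(* Regular parametrization of the set V around its point x0. *)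
Record regular_parametrization (p n : nat) (U : set 'rV[R]_p)
    (phi : 'rV[R]_p -> 'rV[R]_n) (V : set 'rV[R]_n) (x0 : 'rV[R]_n) : Prop := {
  rp_open : open U;
  rp_point : (phi @` U) x0;
  rp_smooth : smooth_map_on U phi;
  rp_inj : forall u u', U u -> U u' -> phi u = phi u' -> u = u';
  rp_rank : forall u, U u -> \rank ('J phi u) = p;
  rp_sub : phi @` U `<=` V;
  rp_cover : exists2 O : set 'rV[R]_n, open_nbhs x0 O & V `&` O `<=` phi @` U
}.

(* V is nonsingular of dimension p around x0: near x0 it is the zero set of
   n - p smooth functions with independent differentials. *)
Definition nonsingular_around (n p : nat) (V : set 'rV[R]_n) (x0 : 'rV[R]_n) :
    Prop :=
  [/\ (p <= n)%N, V x0 &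
    exists O : set 'rV[R]_n, exists g : 'rV[R]_n -> 'rV[R]_(n - p),
      [/\ open_nbhs x0 O, smooth_map_on O g,
          V `&` O = [set x | g x = 0] `&` O &
          forall x, (V `&` O) x -> \rank ('J g x) = (n - p)%N]].

End Geometry.

Section ExponentialFamily.
Variables (R : realType) (d : nat).

Definition borelRd := g_sigma_algebraType (@open 'rV[R]_d).

Variables (Theta : set 'rV[R]_d) (psi : 'rV[R]_d -> R).
Variable nu : {measure set borelRd -> \bar R}.

Definition expfam_density (theta : 'rV[R]_d) (x : borelRd) : R :=
  expR (\sum_(i < d) (x : 'rV[R]_d) ord0 i * theta ord0 i - psi theta).

Definition expfam_law (theta : 'rV[R]_d) (A : set borelRd) : \bar R :=
  (\int[nu]_(x in A) (expfam_density theta x)%:E)%E.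

Definition expectation_param (theta : 'rV[R]_d) : 'rV[R]_d :=
  \row_i partial i psi theta.

Definition fisher (theta : 'rV[R]_d) : 'M[R]_d :=
  \matrix_(i, j) partial i (partial j psi) theta.

Record exponential_family : Prop := {
  ef_open : open Theta;
  ef_smooth : smooth_on Theta psi;
  ef_prob : forall theta, Theta theta -> expfam_law theta setT = 1%E;
  ef_posdef : forall theta, Theta theta -> forall x : 'rV[R]_d, x != 0 ->
    0 < (x *m fisher theta *m x^T) ord0 ord0
}.

(* [thetaOf], defined on the neighbourhood M of the image of theta0, is the
   inverse of the restriction of theta |-> eta(theta) to N. *)
Record local_inverse (theta0 : 'rV[R]_d) (N M : set 'rV[R]_d)
    (thetaOf : 'rV[R]_d -> 'rV[R]_d) : Prop := {
  li_N : open_nbhs theta0 N;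
  li_sub : N `<=` Theta;
  li_M : open M;
  li_image : expectation_param @` N = M;
  li_cancel : forall theta, N theta -> thetaOf (expectation_param theta) = theta
}.

Definition fisher_eta (thetaOf : 'rV[R]_d -> 'rV[R]_d) (y : 'rV[R]_d) :
    'M[R]_d :=
  invmx (fisher (thetaOf y)).

(* The relation eta = eta(theta) is given near (theta0, eta(theta0)) by
   polynomial equations in (theta, eta). *)
Definition locally_polynomial_relation (theta0 : 'rV[R]_d) : Prop :=
  exists k (h : 'I_k -> mpoly (d + d) R) (N M : set 'rV[R]_d),
    [/\ open_nbhs theta0 N, N `<=` Theta,
        open_nbhs (expectation_param theta0) M &
        forall theta y, N theta -> M y ->
          (zero_locus h (row_mx theta y) <-> y = expectation_param theta)].

(* Algebraic curved exponential family of dimension p with natural parameter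
   space VTheta, expectation parameter space VE and true parameter theta0. *)
Record algebraic_curved_family (p : nat) (VTheta VE : set 'rV[R]_d)
    (theta0 : 'rV[R]_d) : Prop := {
  acf_dim : (p < d)%N;
  acf_sub : VTheta `<=` Theta;
  acf_image : VE = expectation_param @` VTheta;
  acf_true : VTheta theta0;
  acf_variety : exists k (P : 'I_k -> mpoly d R),
    VTheta = zero_locus P `&` Theta \/
    VE = zero_locus P `&` (expectation_param @` Theta);
  acf_relation : locally_polynomial_relation theta0;
  acf_nonsingular : nonsingular_around p VE (expectation_param theta0)
}.

End ExponentialFamily.

Section Estimator.
Variables (R : realType) (p q : nat).
Variable H : 'I_(p + q) -> mpoly (p + q) R.

(* The polynomial map w = (u, v) |-> eta(u, v), with (u, v) = [row_mx u v]. *)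
Definition eta_poly (w : 'rV[R]_(p + q)) : 'rV[R]_(p + q) :=
  \row_i poly_eval (H i) w.

Definition slice (W : set 'rV[R]_(p + q)) : set 'rV[R]_p :=
  [set u | W (row_mx u 0)].

(* A polynomial estimator: local coordinates (u, v) on W around eta0, valued in
   the domain M of the local inverse theta(eta), such that u |-> eta(u, 0)
   regularly parametrizes VE.  An observed sample mean X in the image of W is
   written X = eta(u, v), and its u is the estimate. *)
Record polynomial_estimator (VE M : set 'rV[R]_(p + q))
    (eta0 : 'rV[R]_(p + q)) (W : set 'rV[R]_(p + q)) : Prop := {
  est_coord : local_coordinate_system W eta_poly eta0;
  est_dom : eta_poly @` W `<=` M;
  est_param :
    regular_parametrization (slice W) (fun u => eta_poly (row_mx u 0)) VE eta0
}.

End Estimator.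

(* Main.v *)
Require Import Defs.
From HB Require Import structures.
From mathcomp Require Import all_boot all_order all_algebra.
From mathcomp Require Import all_classical all_reals all_analysis.
From mathcomp Require Import -(notations) mpoly.

Import Order.TTheory GRing.Theory Num.Theory.
Import numFieldNormedType.Exports.
Local Open Scope classical_set_scope.
Local Open Scope ring_scope.

(** The normal form has no quadratic terms in v: for
    fixed u the map v |-> eta(u, v) is affine in v up to terms of degree at
    least 3.  Hence every second derivative of eta in the directions v vanishes
    at v = 0, and the contraction with the derivatives of theta in u is a sum of
    zeros.

    The normal form is an identity of values, holding only where (u, v) lies in
    the chart domain W.  Since W is open, it holds for all v near 0, so that
    near 0 the function eta_i(u, -) is the evaluation of a polynomial Q in v
    whose coefficients are real numbers depending on u, and whose coefficients
    of degree 2 are zero.  Second partial derivatives only see the germ of a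
    function ([second_partial_near_poly]), so they can be computed formally on
    Q; their value at 0 is an integer multiple of one coefficient of degree 2
    of Q ([poly_eval_mderiv2_at0]). *)

(** Analytic and formal partial derivatives of a polynomial agree: both are additive and satisfy
    the Leibniz rule, so it is enough to compare them on constants and on
    variables, which generate the polynomials under sums and products. *)
Lemma is_derive_poly_eval (R : realType) (n : nat) (P : mpoly n R) (i : 'I_n)
    (x : 'rV[R]_n) :
  is_derive x (delta_mx ord0 i : 'rV[R]_n) (poly_eval P)
    (poly_eval (mderiv i P) x).
Proof.
pose der (Q : mpoly n R) :=
  is_derive x (delta_mx ord0 i : 'rV[R]_n) (poly_eval Q)
    (poly_eval (mderiv i Q) x).
have derC c : der (mpolyC n c).
  rewrite /der mderivC /poly_eval meval0.
  have -> : (fun y : 'rV[R]_n => meval (fun j => y ord0 j) (mpolyC n c)) = cst c.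
    by apply/funext => y; rewrite mevalC.
  exact: is_derive_cst.
have derD Q1 Q2 : der Q1 -> der Q2 -> der (Q1 + Q2).
  move=> d1 d2; rewrite /der mderivD.
  have -> : poly_eval (Q1 + Q2) = poly_eval Q1 + poly_eval Q2.
    by apply/funext => y; rewrite /poly_eval mevalD.
  by rewrite /poly_eval mevalD; exact: is_deriveD d1 d2.
have derM Q1 Q2 : der Q1 -> der Q2 -> der (Q1 * Q2).
  move=> d1 d2; rewrite /der mderivM.
  have -> : poly_eval (Q1 * Q2) = poly_eval Q1 * poly_eval Q2.
    by apply/funext => y; rewrite /poly_eval mevalM.
  apply: (is_derive_eq (is_deriveM d1 d2)).
  by rewrite /poly_eval mevalD !mevalM addrC /GRing.scale /= [X in X + _]mulrC.
have derX j : der (mpolyX R (mnm1 j)).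
  have eE : poly_eval (mpolyX R (mnm1 j)) = (fun y : 'rV[R]_n => y ord0 j).
    by apply/funext => y; rewrite /poly_eval mevalXU.
  rewrite /der eE mderivX mnm1E.
  have -> : poly_eval ((j == i)%:R *: mpolyX R (mnm_sub (mnm1 j) (mnm1 i))) x
      = (delta_mx ord0 i : 'rV[R]_n) ord0 j.
    rewrite mxE eqxx /= /poly_eval mevalZ eq_sym.
    have [->|_] := eqVneq i j; last by rewrite mul0r.
    by rewrite -[X in mnm_sub X _]add0m addmK mpolyX0 meval1 mulr1.
  (* The difference quotient of a coordinate is constant off h = 0. *)
  have qE : (fun h : R => h^-1 *: (((fun y : 'rV[R]_n => y ord0 j)
       \o shift x) (h *: (delta_mx ord0 i : 'rV[R]_n)) - x ord0 j))
       @ 0^' --> (delta_mx ord0 i : 'rV[R]_n) ord0 j.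
    apply: cvg_near_cst; near=> h.
    rewrite /= mxE addrK mxE /GRing.scale /= mulrA mulVf ?mul1r //.
    by near: h; exact: nbhs_dnbhs_neq.
  by apply: DeriveDef; [apply/cvg_ex; exists ((delta_mx ord0 i : 'rV[R]_n) ord0 j)
                       | apply: cvg_lim].
rewrite -/(der P); elim/mpolyind: P => [|c m P _ _ dP].
  by rewrite -mpolyC0; exact: derC.
apply: derD => //; rewrite -mul_mpolyC; apply: (derM); first exact: derC.
rewrite mpolyXE_id; elim/big_ind: _ => [|Q1 Q2 d1 d2|j _].
- exact: (derC 1).
- exact: derM d1 d2.
elim: (m j) => [|k IHk]; first by rewrite expr0; exact: (derC 1).
by rewrite exprS; apply: (derM).
Unshelve. all: by end_near. Qed.

(** A directional derivative only depends on the restriction of the function to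
    a line; here the line stays in the slice of constant u. *)
Lemma partial_rshift_row_mx (R : realType) (p q : nat) (F : 'rV[R]_(p + q) -> R)
    (u : 'rV[R]_p) (v : 'rV[R]_q) (k : 'I_q) :
  partial (rshift p k) F (row_mx u v)
  = partial k (fun v' => F (row_mx u v')) v.
Proof.
have dE : (delta_mx ord0 (rshift p k) : 'rV[R]_(p + q))
    = row_mx 0 (delta_mx ord0 k).
  apply/rowP => j; rewrite !mxE eqxx /=.
  case: split_ordP => j' ->; rewrite !mxE.
    by rewrite eq_lrshift.
  by rewrite eqxx eq_rshift.
rewrite /partial /derive dE.
by under [in LHS]eq_fun do rewrite /= scale_row_mx scaler0 add_row_mx add0r.
Qed.

Lemma near_row_mx (R : realType) (p q : nat) (W : set 'rV[R]_(p + q))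
    (u : 'rV[R]_p) (v : 'rV[R]_q) :
  open W -> W (row_mx u v) -> \forall v' \near v, W (row_mx u v').
Proof.
move=> oW Wuv; have /nbhs_ballP [r /= r0 rW] := open_nbhs_nbhs (conj oW Wuv).
apply/nbhs_ballP; exists r => //= v' [_ vv']; apply: rW.
split=> // i j; case: (split_ordP j) => k ->.
  by rewrite !row_mxEl; exact: ballxx.
by rewrite !row_mxEr; exact: vv'.
Qed.

(** The inner partial derivative is needed not only at x but at the nearby points
    as well, where the agreement of F with Q is again an agreement near the
    point. *)
Lemma second_partial_near_poly (R : realType) (n : nat) (F : 'rV[R]_n -> R)
    (Q : mpoly n R) (x : 'rV[R]_n) (k l : 'I_n) :
  (\forall y \near x, F y = poly_eval Q y) ->
  partial k (partial l F) x = poly_eval (mderiv k (mderiv l Q)) x.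
Proof.
move=> /near_join FQ.
rewrite /partial.
have -> : 'D_(delta_mx ord0 k) ('D_(delta_mx ord0 l) F) x
    = 'D_(delta_mx ord0 k) (poly_eval (mderiv l Q)) x.
  apply: near_eq_derive; apply: filterS FQ => y Fy.
  rewrite (near_eq_derive _ Fy).
  by have [_ ->] := is_derive_poly_eval R n Q l y.
by have [_ ->] := is_derive_poly_eval R n (mderiv l Q) k x.
Qed.

Lemma poly_eval0 (R : realType) (n : nat) (P : mpoly n R) :
  poly_eval P 0 = mcoeff (@mnm0 n) P.
Proof.
rewrite [in RHS](mpolyE P) raddf_sum /= /poly_eval mevalE.
apply: eq_bigr => m _; rewrite mcoeffZ mcoeffX; congr (_ * _).
have [->|m0] := eqVneq m (@mnm0 n).
  by rewrite big1 // => j _; rewrite mnm0E.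
have [j mj] : exists j, m j != 0%N.
  apply/existsP; apply: contraNT m0 => /existsPn m0.
  by apply/eqP/mnmP => j; rewrite mnm0E; apply/eqP; rewrite -[_ == _]negbK m0.
by rewrite (bigD1 j) //= mxE expr0n (negbTE mj) mul0r.
Qed.

(** The value at 0 of the second derivative in the variables k and l is, up to a
    positive integer factor, the coefficient of the monomial X_k X_l. *)
Lemma poly_eval_mderiv2_at0 (R : realType) (n : nat) (Q : mpoly n R) (k l : 'I_n) :
  (forall m, mdeg m = 2 -> mcoeff m Q = 0) ->
  poly_eval (mderiv k (mderiv l Q)) 0 = 0.
Proof.
by move=> Q2; rewrite poly_eval0 !mcoeff_mderiv Q2 ?mul0rn // !mdegD mdeg0 !mdeg1.
Qed.

Theorem theorem1 (R : realType) (p q : nat)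
  (Theta : set 'rV[R]_(p + q)) (psi : 'rV[R]_(p + q) -> R)
  (nu : {measure set (borelRd R (p + q)) -> \bar R})
  (hfam : exponential_family Theta psi nu)
  (VTheta VE : set 'rV[R]_(p + q)) (theta0 : 'rV[R]_(p + q))
  (hcurved : algebraic_curved_family Theta psi p VTheta VE theta0)
  (N M : set 'rV[R]_(p + q)) (thetaOf : 'rV[R]_(p + q) -> 'rV[R]_(p + q))
  (hinv : local_inverse Theta psi theta0 N M thetaOf)
  (H : 'I_(p + q) -> mpoly (p + q) R) (W : set 'rV[R]_(p + q))
  (hest : polynomial_estimator H VE M (expectation_param psi theta0) W)
  (c : R) (e : 'rV[R]_p -> 'I_(p + q) -> 'rV[R]_(p + q))
  (f : 'I_p -> mpoly q (mpoly p R))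
  (hform : forall (u : 'rV[R]_p) (v : 'rV[R]_q),
    W (row_mx u 0) -> W (row_mx u v) ->
    eta_poly H (row_mx u v) =
      eta_poly H (row_mx u 0)
      + \sum_(k < q) v ord0 k *: e u (rshift p k)
      + c *: \sum_(j < p) poly_eval2 (f j) u v *: e u (lshift q j))
  (hbasis : forall u : 'rV[R]_p, W (row_mx u 0) ->
    basis_of fullv [tuple e u i | i < p + q])
  (horth : forall u : 'rV[R]_p, W (row_mx u 0) ->
    forall (k : 'I_q) (a : 'I_p),
      e u (rshift p k)
      *m fisher_eta psi thetaOf (eta_poly H (row_mx u 0))
      *m ('D_(delta_mx ord0 a) (fun u' => eta_poly H (row_mx u' 0)) u)^T = 0)
  (hdeg : forall j : 'I_p, min_degree_ge 3 (f j)) :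
  forall u : 'rV[R]_p, W (row_mx u 0) ->
  forall (kappa lambda : 'I_q) (a : 'I_p),
    \sum_(i < p + q)
      partial (rshift p kappa)
        (partial (rshift p lambda) (fun w => eta_poly H w ord0 i))
        (row_mx u 0)
      * partial (lshift q a)
          (fun w => thetaOf (eta_poly H w) ord0 i) (row_mx u 0) = 0.
Proof.
move=> u Wu k l a; apply: big1 => i _.
suff -> : partial (rshift p k)
    (partial (rshift p l) (fun w => eta_poly H w ord0 i)) (row_mx u 0) = 0.
  by rewrite mul0r.
have WE : (fun v => partial (rshift p l) (fun w => eta_poly H w ord0 i)
    (row_mx u v)) = partial l (fun v => eta_poly H (row_mx u v) ord0 i).
  by apply/funext => v; rewrite partial_rshift_row_mx.
rewrite partial_rshift_row_mx WE.
(* Q is the normal form of the i-th coordinate of eta with u frozen. *)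
pose Q : mpoly q R :=
  mpolyC q (eta_poly H (row_mx u 0) ord0 i)
  + \sum_(m < q) e u (rshift p m) ord0 i *: mpolyX R (mnm1 m)
  + c *: \sum_(j < p) e u (lshift q j) ord0 i
         *: map_mpoly (meval (fun i => u ord0 i)) (f j).
have QE : \forall v \near (0 : 'rV[R]_q),
    eta_poly H (row_mx u v) ord0 i = poly_eval Q v.
  have oW : open W by exact: lcs_open (est_coord hest).
  near=> v.
  have Wuv : W (row_mx u v) by near: v; exact: near_row_mx.
  rewrite hform // /Q /poly_eval !mevalD mevalC mevalZ !raddf_sum /= !mxE !summxE.
  rewrite mulr_sumr; congr (_ + _ + _); apply: eq_bigr => j _.
    by rewrite mevalZ mevalXU mxE mulrC.
  by rewrite mevalZ !mxE [X in _ = _ * X]mulrC.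
(* Each summand of Q misses degree 2: a constant, linear monomials, and the f_j. *)
rewrite (second_partial_near_poly _ _ _ _ _ _ _ QE) poly_eval_mderiv2_at0 // => m m2.
rewrite /Q !mcoeffD mcoeffC mcoeffZ !raddf_sum /=.
have -> : (m == @mnm0 q) = false by rewrite -mdeg_eq0 m2.
rewrite mulr0 add0r !big1 ?mulr0 ?addr0 // => j _; rewrite mcoeffZ.
  rewrite mcoeff_map_mpoly memN_msupp_eq0 ?raddf0 ?mulr0 //.
  by apply/negP => /(hdeg j); rewrite m2.
rewrite mcoeffX; have [jm|_] := eqVneq; last by rewrite mulr0.
by rewrite -jm mdeg1 in m2.
Unshelve. all: by end_near. Qed.
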